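(* Let $X=(V,E)$ be a $d$-regular $\lambda$-expander, let $n\ge 1$, $k\ge 2$, and let $\mathcal{S}=\{i_1<i_2<\cdots<i_k\}\subseteq[n]$. For $j\in[k]$ let $f_j\colon V\to\mathbb{C}^{d_j\times d_j}$ be matrix-valued functions with $\mathbb{E}_{x\sim V}[f_j(x)]=0$ ($x$ uniform on $V$) and $\max_{x\in V}\|f_j(x)\|_{\mathrm{op}}\le 1$. Then \[ \Big\|\mathbb{E}_{(x_1,\dots,x_n)\sim \mathrm{RW}_n}\big[f_1(x_{i_1})\otimes f_2(x_{i_2})\otimes\cdots\otimes f_k(x_{i_k})\big]\Big\|_{\mathrm{op}}\;\le\;\sum_{I\in\mathcal{I}_k}\lambda^{\sum_{j\in I}\Delta_j(\mathcal{S})}. \]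
   Context: $X$ is a $\lambda$-expander if all eigenvalues of its degree-normalized adjacency matrix $A_X$, other than the top eigenvalue $1$ (counted once), have absolute value at most $\lambda$. $\mathrm{RW}_n$ is the distribution of a random walk $(x_1,\dots,x_n)$ on $X$ with $n$ vertices: $x_1$ uniform on $V$ and $x_{l+1}$ a uniformly random neighbour of $x_l$. $\Delta_j(\mathcal{S})=i_{j+1}-i_j$ for $j\in[k-1]$. $\mathcal{I}_k$ is the family of sets $I$ with $\{1,k-1\}\subseteq I\subseteq[k-1]$ such that for every $1<j<k-1$, $\{j,j+1\}\cap I\neq\emptyset$. $\|\cdot\|_{\mathrm{op}}$ is the operator norm. *)

(* Defs.v *)
From HB Require Import structures.
From mathcomp Require Import all_boot all_order all_algebra.
From mathcomp Require Import all_classical all_reals all_analysis.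
From mathcomp Require Import complex mxtens.

Set Implicit Arguments.
Unset Strict Implicit.
Unset Printing Implicit Defensive.

Import Order.TTheory GRing.Theory Num.Theory.

Local Open Scope ring_scope.
Local Open Scope complex_scope.

(* A graph is a symmetric relation; loops are allowed and count once in the
   degree, so simple graphs are the irreflexive case. *)
Section Graph.
Variables (V : finType) (e : rel V).

Definition nbrs (x : V) : {set V} := [set y | e x y].

Definition regular (d : nat) : Prop := forall x, #|nbrs x| = d.

End Graph.

Section Expander.
Variable R : realType.

Definition normalized_adj (V : finType) (e : rel V) (d : nat) : 'M[R[i]]_#|V| :=
  \matrix_(a, b) ((e (enum_val a) (enum_val b))%:R / d%:R).

(* Roots of the characteristic polynomial, repeated according to their
   algebraic multiplicities: the sequence s returned by
   [closed_field_poly_normal] satisfies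
   char_poly A = \prod_(z <- s) ('X - z%:P), since char_poly A is monic. *)
Definition eigenvalues m (A : 'M[R[i]]_m) : seq R[i] :=
  sval (closed_field_poly_normal (char_poly A)).

(* [rem 1] deletes a single occurrence of 1: in a disconnected graph the
   eigenvalue 1 is repeated and its other occurrences are still constrained. The sign of lam is left
   free here: on a one-vertex graph (a loop) the condition is empty, and
   0 <= lam has to be assumed separately. *)
Definition expander (V : finType) (e : rel V) (d : nat) (lam : R) : Prop :=
  {in rem 1 (eigenvalues (normalized_adj e d)), forall z, `|z| <= lam%:C}.

End Expander.

Section Walk.
Variable R : realType.

Definition unif (T : finType) (A : {set T}) (x : T) : R :=
  (x \in A)%:R / #|A|%:R.

Definition expect (T : finType) (p : T -> R) m (F : T -> 'M[R[i]]_m) : 'M[R[i]]_m :=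
  \sum_t (p t)%:C *: F t.

Variables (V : finType) (e : rel V).

Fixpoint walk_from (x : V) (w : seq V) : R :=
  if w is y :: w' then unif (nbrs e x) y * walk_from y w' else 1.

Definition RW (n : nat) (w : n.-tuple V) : R :=
  if val w is x :: w' then unif [set: V] x * walk_from x w' else 1.

End Walk.

Section OperatorNorm.
Variable R : realType.

Definition l2norm m (v : 'cV[R[i]]_m) : R :=
  Num.sqrt (\sum_a Normc.normc (v a 0) ^+ 2).

Definition opnorm m (A : 'M[R[i]]_m) : R :=
  sup [set l2norm (A *m v) | v in [set v | l2norm v <= 1]]%classic.

End OperatorNorm.

(* M_1 (x) ... (x) M_k, as an iterated Kronecker product; the empty product is
   the 1 x 1 identity, which is why the dimension ends with a factor 1. *)
Fixpoint tens_dim (k : nat) : ('I_k -> nat) -> nat :=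
  match k with
  | 0 => fun _ => 1
  | k'.+1 => fun D => (D ord0 * tens_dim (fun j => D (lift ord0 j)))%N
  end.

Fixpoint tens (K : comNzRingType) (k : nat) :
    forall D : 'I_k -> nat, (forall j, 'M[K]_(D j)) -> 'M[K]_(tens_dim D) :=
  match k return forall D : 'I_k -> nat,
      (forall j, 'M[K]_(D j)) -> 'M[K]_(tens_dim D) with
  | 0 => fun _ _ => 1%:M
  | k'.+1 => fun D M =>
      tensmx (M ord0) (tens (fun j : 'I_k' => M (lift ord0 j)))
  end.

(* All indices are counted from 0: the position i_(j+1) of the walk is the
   j-th entry of S (with values in 0 .. n-1), and [gap S j] is Delta_(j+1). *)
Definition gap n k (S : k.-tuple 'I_n) (j : nat) : nat :=
  (nth 0 (map val S) j.+1 - nth 0 (map val S) j)%N.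

(* The family I_k, with the index j of [k-1] represented by j-1 in 'I_k.-1. *)
Definition index_family (k : nat) : {set {set 'I_k.-1}} :=
  [set I : {set 'I_k.-1} |
    [forall j : 'I_k.-1, (j == 0 :> nat) || (j == k.-2 :> nat) ==> (j \in I)] &&
    [forall j : 'I_k.-1, forall j' : 'I_k.-1,
       (0 < j)%N && (j' == j.+1 :> nat) ==> (j \in I) || (j' \in I)]].

(* Main.v *)
(* Placing the uniform kernel J in front of the walk, the expectation is the
   value of a product alternating the kernels J, A^Delta_1, ..., A^Delta_(k-1)
   with the (block diagonal) multiplications by f_1, ..., f_k.  Writing each
   A^Delta_j as J + (A^Delta_j - J) and expanding gives one term for every
   I in [k-1], the set of gaps where the second summand is chosen.  Since the
   f_j have mean zero, a term vanishes as soon as J occurs on both sides of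
   some f_j or just before f_k, that is, when I is not in I_k; otherwise its
   norm is at most the product of the norms of the A^Delta_j - J, each at most
   lambda^Delta_j by the spectral theorem. *)

Require Import Defs.
From mathcomp Require Import all_boot all_order all_algebra.
From mathcomp Require Import all_classical all_reals all_analysis.
From mathcomp Require Import complex mxtens.
From mathcomp Require Import ring.

Set Implicit Arguments.
Unset Strict Implicit.
Unset Printing Implicit Defensive.

Import Order.TTheory GRing.Theory Num.Theory Normc.

Local Open Scope ring_scope.
Local Open Scope complex_scope.

(** * Squared Euclidean norms and the operator norm *)

Section SquaredNorm.
Variable R : realType.

Definition nsq m (v : 'cV[R[i]]_m) : R := \sum_a normc (v a 0) ^+ 2.

Lemma nsq_ge0 m (v : 'cV[R[i]]_m) : 0 <= nsq v.
Proof. by apply: sumr_ge0 => a _; exact: sqr_ge0. Qed.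

Lemma normc_ge0 (z : R[i]) : 0 <= normc z.
Proof. by case: z => x y; exact: sqrtr_ge0. Qed.

Lemma l2norm_ge0 m (v : 'cV[R[i]]_m) : 0 <= l2norm v.
Proof. exact: sqrtr_ge0. Qed.

Lemma sqr_l2norm m (v : 'cV[R[i]]_m) : l2norm v ^+ 2 = nsq v.
Proof. by rewrite sqr_sqrtr // nsq_ge0. Qed.

Lemma l2norm_le m (v : 'cV[R[i]]_m) c : 0 <= c -> (l2norm v <= c) = (nsq v <= c ^+ 2).
Proof.
by move=> c0; rewrite -sqr_l2norm ler_pXn2r // nnegrE l2norm_ge0.
Qed.

Lemma nsqZ m a (v : 'cV[R[i]]_m) : nsq (a *: v) = normc a ^+ 2 * nsq v.
Proof.
by rewrite /nsq mulr_sumr; apply: eq_bigr => i _; rewrite mxE normcM exprMn.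
Qed.

Lemma normc_real (a : R) : normc a%:C = `|a|.
Proof. by rewrite /= expr0n addr0 sqrtr_sqr. Qed.

Lemma nsqC m (v : 'cV[R[i]]_m) : (nsq v)%:C = \sum_a `|v a 0| ^+ 2.
Proof.
rewrite /nsq rmorph_sum; apply: eq_bigr => a _.
by rewrite rmorphXn.
Qed.

Lemma nsq0 m : nsq (0 : 'cV[R[i]]_m) = 0.
Proof. by rewrite /nsq big1 // => a _; rewrite mxE normc0 expr0n. Qed.

Lemma nsq_eq0 m (v : 'cV[R[i]]_m) : nsq v = 0 -> v = 0.
Proof.
move=> /eqP; rewrite psumr_eq0 => [/allP v0|a _]; last exact: sqr_ge0.
apply/matrixP => a j; rewrite ord1 mxE.
by apply: eq0_normc; apply/eqP; rewrite -sqrf_eq0; have := v0 a (mem_index_enum _).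
Qed.

(* Convexity of the square, with weights a/(a+b) and b/(a+b). *)
Lemma sqr_normcD_le (x y : R[i]) (a b : R) : 0 < a -> 0 < b ->
  normc (x + y) ^+ 2 <= (a + b) * (normc x ^+ 2 / a + normc y ^+ 2 / b).
Proof.
move=> a0 b0; apply: (@le_trans _ _ ((normc x + normc y) ^+ 2)).
  by rewrite ler_pXn2r ?nnegrE ?addr_ge0 ?normc_ge0 ?le_normcD.
set p := normc x; set q := normc y.
rewrite -subr_ge0.
have -> : (a + b) * (p ^+ 2 / a + q ^+ 2 / b) - (p + q) ^+ 2
  = (b * p - a * q) ^+ 2 / (a * b).
  by field; rewrite !gt_eqF.
by rewrite divr_ge0 ?sqr_ge0 // mulr_ge0 ?ltW.
Qed.

(** This is the triangle inequality in squared form: the convexity bound is summed over coordinates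
    with weights [a] and [b]. The weights are divided by, so [a = 0] and [b = 0] are treated first;
    there the corresponding vector is 0. *)
Lemma nsqD_le m (u v : 'cV[R[i]]_m) a b : 0 <= a -> 0 <= b ->
  nsq u <= a ^+ 2 -> nsq v <= b ^+ 2 -> nsq (u + v) <= (a + b) ^+ 2.
Proof.
rewrite le0r => /orP[/eqP-> _|a0].
  rewrite expr0n add0r /= => u0; have -> : u = 0.
    by apply: nsq_eq0; apply/eqP; rewrite eq_le u0 nsq_ge0.
  by rewrite add0r.
rewrite le0r => /orP[/eqP->|b0].
  rewrite expr0n addr0 /= => hu u0; have -> : v = 0.
    by apply: nsq_eq0; apply/eqP; rewrite eq_le u0 nsq_ge0.
  by rewrite addr0.
move=> hu hv.
apply: (@le_trans _ _ ((a + b) * (nsq u / a + nsq v / b))).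
  rewrite /nsq !mulr_suml -big_split mulr_sumr /=.
  by apply: ler_sum => i _; rewrite mxE sqr_normcD_le.
rewrite expr2 ler_pM2l ?addr_gt0 //; apply: lerD.
  by rewrite ler_pdivrMr // -expr2.
by rewrite ler_pdivrMr // -expr2.
Qed.

Lemma nsq_sum_le (I : finType) (P : pred I) m (u : I -> 'cV[R[i]]_m) (c : I -> R) :
  (forall i, P i -> 0 <= c i) -> (forall i, P i -> nsq (u i) <= c i ^+ 2) ->
  nsq (\sum_(i | P i) u i) <= (\sum_(i | P i) c i) ^+ 2.
Proof.
move=> c0 h.
pose Q v r := 0 <= r /\ @nsq m v <= r ^+ 2.
suff: Q (\sum_(i | P i) u i) (\sum_(i | P i) c i) by case.
apply: (big_ind2 Q) => [|v a w b [a0 va] [b0 wb]|i Pi].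
- by split; rewrite ?nsq0 ?expr0n.
- by split; [exact: addr_ge0 | exact: nsqD_le].
- by split; [exact: c0 | exact: h].
Qed.

Lemma opnorm_le m (A : 'M[R[i]]_m) c : 0 <= c ->
  (forall v, nsq (A *m v) <= c ^+ 2 * nsq v) -> opnorm A <= c.
Proof.
move=> c0 h; apply: ge_sup.
  by exists (l2norm (A *m 0)), 0 => //=; rewrite l2norm_le // nsq0.
move=> _ [v /= v1 <-]; rewrite l2norm_le //; apply: le_trans (h v) _.
by rewrite ler_piMr ?sqr_ge0 //; rewrite l2norm_le // expr1n in v1.
Qed.

Lemma normc_sum_le (I : finType) (F : I -> R[i]) :
  normc (\sum_i F i) <= \sum_i normc (F i).
Proof.
apply: (big_ind2 (fun x y => normc x <= y)) => [|x a y b ha hb|//].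
  by rewrite normc0.
by apply: le_trans (le_normcD _ _) _; exact: lerD.
Qed.

(** A supremum dominates the elements of its set only if the set is bounded above. Every coordinate
    of a vector in the unit ball has modulus at most 1, so the absolute row sums of [A] bound the
    coordinates of [A *m v]. *)
Lemma opnorm_has_ubound m (A : 'M[R[i]]_m) :
  has_ubound [set l2norm (A *m v) | v in [set v | l2norm v <= 1]]%classic.
Proof.
exists (Num.sqrt (\sum_a (\sum_b normc (A a b)) ^+ 2)) => _ [v /= v1 <-].
rewrite ler_sqrt; last by apply: sumr_ge0 => a _; exact: sqr_ge0.
apply: ler_sum => a _; rewrite ler_pXn2r ?nnegrE ?normc_ge0 //; last first.
  by apply: sumr_ge0 => b _; exact: normc_ge0.
rewrite mxE; apply: le_trans (normc_sum_le _) _.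
apply: ler_sum => b _; rewrite normcM ler_piMr ?normc_ge0 //.
rewrite -(@ler_pXn2r _ 2) ?nnegrE ?normc_ge0 // expr1n.
move: v1; rewrite l2norm_le // expr1n; apply: le_trans.
rewrite /nsq (bigD1 b) //= lerDl.
by apply: sumr_ge0 => i _; exact: sqr_ge0.
Qed.

(** A nonzero [v] is rescaled to the unit vector [u], where the supremum defining [opnorm]
    applies. *)
Lemma opnorm_le1 m (A : 'M[R[i]]_m) v : opnorm A <= 1 -> nsq (A *m v) <= nsq v.
Proof.
move=> A1; have [v0|v0] := eqVneq (l2norm v) 0.
  have -> : v = 0 by apply: nsq_eq0; rewrite -sqr_l2norm v0 expr0n.
  by rewrite mulmx0.
have vp : 0 < l2norm v by rewrite lt_neqAle eq_sym v0 l2norm_ge0.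
pose u := ((l2norm v)^-1)%:C *: v.
have nuv w : nsq (((l2norm v)^-1)%:C *: (w : 'cV_m)) = nsq w / nsq v.
  by rewrite nsqZ normc_real ger0_norm ?invr_ge0 ?ltW // exprVn sqr_l2norm mulrC.
have vv : 0 < nsq v by rewrite -sqr_l2norm exprn_gt0.
have u1 : l2norm u <= 1 by rewrite l2norm_le // nuv expr1n divff // gt_eqF.
have : l2norm (A *m u) <= 1.
  by apply: le_trans A1; apply: ub_le_sup; [exact: opnorm_has_ubound | exists u].
by rewrite l2norm_le // /u -scalemxAr nuv expr1n ler_pdivrMr // mul1r.
Qed.

End SquaredNorm.

(** * Sums over tuples and tensor indices, linearity of the Kronecker product *)

Lemma big_tuple_cons (T : finType) (V : nmodType) n (F : n.+1.-tuple T -> V) :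
  \sum_t F t = \sum_x \sum_(t : n.-tuple T) F [tuple of x :: t].
Proof.
rewrite pair_big /= (reindex (fun p : T * n.-tuple T => [tuple of p.1 :: p.2])) //=.
exists (fun t => (thead t, [tuple of behead t])) => [[x t] _|t _] /=.
  by congr (_, _); apply: val_inj.
by rewrite [RHS]tuple_eta.
Qed.

Lemma big_tuple_nil (T : finType) (V : nmodType) (F : 0.-tuple T -> V) :
  \sum_t F t = F [tuple].
Proof. by rewrite (big_pred1 [tuple]) // => t; apply/esym/eqP; exact: tuple0. Qed.

Lemma big_mxtens (V : nmodType) p q (F : 'I_(p * q) -> V) :
  \sum_c F c = \sum_a \sum_b F (mxtens_index (a, b)).
Proof.
rewrite pair_big /= (reindex (@mxtens_index p q)) /=.
  by apply: eq_bigr => -[].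
by exists (@mxtens_unindex p q) => i _; rewrite ?mxtens_indexK ?mxtens_unindexK.
Qed.

Section TensorLinearity.
Variables (K : comNzRingType) (p q : nat).

Lemma tensmx_sumr (I : finType) (M : 'M[K]_p) (N : I -> 'M[K]_q) :
  tensmx M (\sum_i N i) = \sum_i tensmx M (N i).
Proof.
apply/matrixP => i j; rewrite summxE !mxE summxE mulr_sumr.
by apply: eq_bigr => l _; rewrite mxE.
Qed.

Lemma tensmx_suml (I : finType) (M : I -> 'M[K]_p) (N : 'M[K]_q) :
  tensmx (\sum_i M i) N = \sum_i tensmx (M i) N.
Proof.
apply/matrixP => i j; rewrite summxE !mxE summxE mulr_suml.
by apply: eq_bigr => l _; rewrite mxE.
Qed.

Lemma tensmxZr a (M : 'M[K]_p) (N : 'M[K]_q) :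
  tensmx M (a *: N) = a *: tensmx M N.
Proof. by apply/matrixP => i j; rewrite !mxE mulrCA. Qed.

End TensorLinearity.

(** * Products alternating transition kernels and matrix-valued functions *)

Section Chain.
Variables (R : realType) (m : nat).
Local Notation C := R[i].

(* From state [x], move by the kernel [T 0], read off [g 0] at the new state,
   move by [T 1], read off [g 1], etc. *)
Fixpoint chain (k : nat) : forall D : 'I_k -> nat,
    (forall j, 'I_m -> 'M[C]_(D j)) -> (nat -> 'M[C]_m) -> 'I_m ->
    'M[C]_(tens_dim D) :=
  match k with
  | 0 => fun _ _ _ _ => 1%:M
  | k'.+1 => fun D g T x =>
      \sum_y T 0%N x y *: tensmx (g ord0 y)
        (chain (fun j => g (lift ord0 j)) (fun j => T j.+1) y)
  end.

Lemma eq_chain k (D : 'I_k -> nat) (g : forall j, 'I_m -> 'M[C]_(D j)) T T' x :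
  (forall j, (j < k)%N -> T j = T' j) -> chain g T x = chain g T' x.
Proof.
elim: k D g T T' x => [//|k IH] D g T T' x h /=.
apply: eq_bigr => y _; rewrite h //; congr (_ *: tensmx _ _).
by apply: IH => j jk; rewrite h.
Qed.

(** A chain is additive in each of its kernels; the bits of [b] record which summand is chosen at
    each step. *)
Lemma chainD k (D : 'I_k -> nat) (g : forall j, 'I_m -> 'M[C]_(D j))
    (P Q : nat -> 'M[C]_m) x :
  chain g (fun j => P j + Q j) x =
  \sum_(b : k.-tuple bool)
    chain g (fun j => if nth false b j then Q j else P j) x.
Proof.
elim: k D g P Q x => [|k IH] D g P Q x; first by rewrite big_tuple_nil.
rewrite big_tuple_cons big_bool /= exchange_big [X in _ = _ + X]exchange_big /=.
rewrite addrC -big_split /=; apply: eq_bigr => y _.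
rewrite mxE scalerDl IH tensmx_sumr !scaler_sumr.
by congr (_ + _).
Qed.

(** The kernel acts as [T] tensored with the identity, so the bound for [T] applies to each
    coordinate [a] of the family [u] separately. *)
Lemma nsq_kernel (T : 'M[C]_m) (c : R) n (u : 'I_m -> 'cV[C]_n) :
  (forall v, nsq (T *m v) <= c ^+ 2 * nsq v) ->
  \sum_x nsq (\sum_y T x y *: u y) <= c ^+ 2 * \sum_y nsq (u y).
Proof.
move=> h; rewrite /nsq exchange_big /= [X in _ <= _ * X]exchange_big /= mulr_sumr.
apply: ler_sum => a _.
have := h (\col_y u y a 0); rewrite /nsq.
under [X in _ <= _ * X -> _]eq_bigr do rewrite mxE.
move=> /(le_trans _); apply; apply: ler_sum => x _.
rewrite summxE mxE; under eq_bigr do rewrite mxE.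
by under [X in _ <= normc X ^+ 2]eq_bigr do rewrite mxE.
Qed.

Definition slice p q (v : 'cV[C]_(p * q)) (a : 'I_p) : 'cV[C]_q :=
  \col_b v (mxtens_index (a, b)) 0.

Lemma nsq_slice p q (v : 'cV[C]_(p * q)) : nsq v = \sum_a nsq (slice v a).
Proof.
rewrite /nsq big_mxtens; apply: eq_bigr => a _; apply: eq_bigr => b _.
by rewrite mxE.
Qed.

(** The product factors as [M] tensored with the identity after the identity tensored with [N]. For
    each fixed second index [b], the contraction [M] acts on the vector of [b]-th entries of
    [N *m slice v a]. *)
Lemma nsq_tensmx p q (M : 'M[C]_p) (N : 'M[C]_q) (v : 'cV[C]_(p * q)) :
  (forall w, nsq (M *m w) <= nsq w) ->
  nsq (tensmx M N *m v) <= \sum_a nsq (N *m slice v a).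
Proof.
move=> h; rewrite {1}/nsq big_mxtens /= exchange_big.
rewrite /nsq [X in _ <= X]exchange_big /=; apply: ler_sum => b _.
have := h (\col_a (N *m slice v a) b 0); rewrite /nsq.
under [X in _ <= X -> _]eq_bigr do rewrite mxE.
move=> /(le_trans _); apply; apply: ler_sum => a _.
rewrite [X in normc X]mxE big_mxtens [X in _ <= normc X ^+ 2]mxE.
suff -> : \sum_a' \sum_b' tensmx M N (mxtens_index (a, b)) (mxtens_index (a', b'))
   * v (mxtens_index (a', b')) 0 =
   \sum_j M a j * (\col_a0 (N *m slice v a0) b 0) j 0 by [].
apply: eq_bigr => a' _; rewrite !mxE mulr_sumr; apply: eq_bigr => b' _.
by rewrite tensmxE mxE mulrA.
Qed.

(** Each step of the induction peels off one kernel by [nsq_kernel] and one function by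
    [nsq_tensmx]. The factor [m] comes from the empty chain, which contributes [nsq v] for each of
    the [m] starting states. *)
Lemma chain_nsq_le k (D : 'I_k -> nat) (g : forall j, 'I_m -> 'M[C]_(D j))
    (T : nat -> 'M[C]_m) (c : nat -> R) v :
  (forall j x w, nsq (g j x *m w) <= nsq w) ->
  (forall j w, (j < k)%N -> nsq (T j *m w) <= c j ^+ 2 * nsq w) ->
  \sum_x nsq (chain g T x *m v) <= m%:R * (\prod_(j < k) c j) ^+ 2 * nsq v.
Proof.
elim: k D g T c v => [|k IH] D g T c v hg hT /=.
  rewrite big_ord0 expr1n mulr1; under eq_bigr do rewrite mul1mx.
  by rewrite sumr_const card_ord mulr_natl.
under eq_bigr => x _.
  rewrite mulmx_suml; under eq_bigr do rewrite -scalemxAl.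
over.
apply: le_trans (nsq_kernel _ (fun w => hT 0%N w isT)) _.
rewrite big_ord_recl /= exprMn (mulrCA m%:R) -(mulrA (c 0%N ^+ 2)) ler_wpM2l ?sqr_ge0 //.
pose H y := chain (fun j => g (lift ord0 j)) (fun j => T j.+1) y.
apply: (@le_trans _ _ (\sum_y \sum_a nsq (H y *m slice v a))).
  apply: ler_sum => y _; apply: nsq_tensmx => w; exact: hg.
rewrite exchange_big /= nsq_slice mulr_sumr; apply: ler_sum => a _.
by apply: (IH _ _ _ (fun j => c j.+1)) => [j y w|j w jk]; [exact: hg | exact: hT].
Qed.

(** A constant kernel before [g j] gives every state the same weight, and a constant kernel after it
    (or the end of the chain) makes the remainder independent of that state. So the mean of [g j]
    factors out. *)
Lemma chain_eq0 k (D : 'I_k -> nat) (g : forall j, 'I_m -> 'M[C]_(D j))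
    (T : nat -> 'M[C]_m) j x :
  (forall j, \sum_y g j y = 0) -> (j < k)%N ->
  T j = const_mx m%:R^-1 ->
  ((j.+1 < k)%N -> T j.+1 = const_mx m%:R^-1) -> chain g T x = 0.
Proof.
elim: k D g T j x => [//|k IH] D g T [|j] x hg jk Tj Tj1 /=; last first.
  apply: big1 => y _; rewrite (IH _ _ _ j) ?tensmx0 ?scaler0 //.
pose H y := chain (fun j => g (lift ord0 j)) (fun j => T j.+1) y.
have Hconst y : H y = H x.
  rewrite /H; case: k {IH} D g hg jk Tj1 {H} => [//|k] D g hg jk Tj1 /=.
  by rewrite Tj1 //; apply: eq_bigr => z _; rewrite !mxE.
under eq_bigr => y _.
  rewrite -/(H y) Hconst Tj mxE; over.
by rewrite -scaler_sumr -tensmx_suml hg tens0mx scaler0.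
Qed.

End Chain.

(** * Spectral bound for a Hermitian matrix fixing the constant vector *)

Section Spectral.
Variable R : realType.
Local Notation C := R[i].

Lemma char_poly_similar (K : comUnitRingType) m (P A : 'M[K]_m) : P \in unitmx ->
  char_poly (invmx P *m A *m P) = char_poly A.
Proof.
move=> Pu; rewrite /char_poly.
have PQ : map_mx polyC (invmx P) *m map_mx polyC P = 1%:M.
  by rewrite -map_mxM mulVmx // map_mx1.
have -> : char_poly_mx (invmx P *m A *m P) =
    map_mx polyC (invmx P) *m char_poly_mx A *m map_mx polyC P.
  rewrite /char_poly_mx !map_mxM mulmxBr mulmxBl; congr (_ - _).
  by rewrite scalar_mxC -mulmxA PQ mulmx1.
by rewrite !det_mulmx mulrAC -det_mulmx PQ det1 mul1r.
Qed.

(** Both lists give the linear factors of the same characteristic polynomial, which determine them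
    up to order. *)
Lemma eigenvalues_perm m (A : 'M[C]_m) (P : 'M[C]_m) (sp : 'rV[C]_m) :
  P \in unitmx -> A = invmx P *m diag_mx sp *m P ->
  perm_eq (eigenvalues A) [seq sp 0 i | i <- index_enum 'I_m].
Proof.
move=> Pu defA; apply: prod_XsubC_eq; rewrite big_map.
rewrite /eigenvalues; case: closed_field_poly_normal => s /= hs.
move: hs; rewrite (monicP (char_poly_monic A)) scale1r => <-.
rewrite defA char_poly_similar // char_poly_trig ?diag_mx_is_trig //.
by apply: eq_bigr => i _; rewrite mxE eqxx.
Qed.

Local Open Scope sesquilinear_scope.

Lemma dotE m (u v : 'cV[C]_m) : (u^t* *m v) 0 0 = \sum_a (u a 0)^* * v a 0.
Proof. by rewrite mxE; apply: eq_bigr => a _; rewrite !mxE. Qed.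

Lemma nsq_dot m (v : 'cV[C]_m) : (nsq v)%:C = (v^t* *m v) 0 0.
Proof.
by rewrite nsqC dotE; apply: eq_bigr => a _; rewrite normCK mulrC.
Qed.

Lemma dot_unitary m (P : 'M[C]_m) (u v : 'cV[C]_m) : P \is unitarymx ->
  (P *m u)^t* *m (P *m v) = u^t* *m v.
Proof.
move=> Pu; rewrite trmx_mul map_mxM.
have PP : P^t* *m P = 1%:M by rewrite -invmx_unitary // mulVmx // unitarymx_unit.
by rewrite mulmxA -(mulmxA _ _ P) PP mulmx1.
Qed.

Lemma nsq_unitary m (P : 'M[C]_m) (v : 'cV[C]_m) : P \is unitarymx ->
  nsq (P *m v) = nsq v.
Proof. by move=> Pu; apply: complexI; rewrite !nsq_dot dot_unitary. Qed.

Variables (m : nat) (A : 'M[C]_m) (lam : R).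
Local Notation one := (const_mx 1 : 'cV[C]_m).
Hypotheses (m_gt0 : (0 < m)%N) (A_herm : A \is hermsymmx) (A_one : A *m one = one).
Hypothesis A_gap : {in rem 1 (eigenvalues A), forall z, `|z| <= lam%:C}.

(* If an eigenvalue of A is not controlled by [A_gap], it is a simple
   eigenvalue 1, whose eigenvector is [one]. *)
Lemma nsq_orth_le (w : 'cV[C]_m) : one^t* *m w = 0 ->
  nsq (A *m w) <= lam ^+ 2 * nsq w.
Proof.
move=> w_orth.
set P := spectralmx A; set sp := spectral_diag A.
have Pu : P \is unitarymx := spectral_unitarymx A.
have defA : A = invmx P *m diag_mx sp *m P.
  exact/orthomx_spectralP/hermitian_normalmx.
have perm := eigenvalues_perm (unitarymx_unit Pu) defA.
have PA (v : 'cV_m) : P *m (A *m v) = diag_mx sp *m (P *m v).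
  by rewrite {1}defA !mulmxA mulmxV ?unitarymx_unit // mul1mx.
pose u := P *m one.
(* Since [A] fixes [one], its image [u] in the eigenbasis is supported on the eigenvalue 1. *)
have u_fix i : u i 0 != 0 -> sp 0 i = 1.
  move=> ui0; apply: (mulIf ui0); rewrite mul1r.
  by have /matrixP/(_ i 0) := PA one; rewrite A_one mul_diag_mx -/u [RHS]mxE => <-.
have u_ne0 : exists i, u i 0 != 0.
  apply/existsP; apply: contraT; rewrite negb_exists => /forallP u0.
  have : u = 0.
    apply/matrixP => i j; rewrite ord1 [RHS]mxE; apply/eqP.
    by have := u0 i; rewrite negbK.
  move=> /(congr1 (mulmx (invmx P))); rewrite mulmx0 mulKmx ?unitarymx_unit //.
  move=> /matrixP/(_ (Ordinal m_gt0) 0); rewrite !mxE => /eqP.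
  by rewrite oner_eq0.
rewrite -(nsq_unitary (A *m w) Pu) PA -[X in _ <= _ * X](nsq_unitary w Pu).
set z := P *m w; rewrite /nsq mulr_sumr; apply: ler_sum => i _.
have -> : (diag_mx sp *m z) i 0 = sp 0 i * z i 0 by rewrite mul_diag_mx [LHS]mxE.
rewrite normcM exprMn.
have [spi|spi] := boolP (sp 0 i \in rem 1 (eigenvalues A)).
  rewrite ler_wpM2r ?sqr_ge0 //.
  have := A_gap spi; rewrite lecR => le_lam.
  by rewrite ler_pXn2r ?nnegrE ?normc_ge0 // (le_trans _ le_lam) ?normc_ge0.
have spi_in : sp 0 i \in eigenvalues A.
  by rewrite (perm_mem perm) map_f // mem_index_enum.
have spi1 : sp 0 i = 1.
  by apply/eqP; apply: contraNT spi => ne; rewrite rem_mem // eq_sym.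
(* A second index with eigenvalue 1 would leave a copy of 1 in the list after the single removal. *)
have uniq1 j : sp 0 j = 1 -> j = i.
  move=> spj1; apply/eqP; apply: contraNT spi => ji.
  rewrite spi1 -has_pred1 has_count count_mem_rem eqxx.
  rewrite (permP perm) count_map subn_gt0.
  rewrite -sum1_count (bigD1 i) /= ?spi1 //.
  by rewrite (bigD1 j) /= ?spj1 ?eqxx ?ji.
have ui : u i 0 != 0 by case: u_ne0 => j uj; rewrite -(uniq1 j) // u_fix.
(* Only the [i]-th coordinate of [u] is nonzero, so orthogonality forces [z i 0 = 0]. *)
have : (u^t* *m z) 0 0 = 0 by rewrite dot_unitary // w_orth mxE.
rewrite dotE (bigD1 i) //= big1 => [|j ji]; last first.
  have [->|uj] := eqVneq (u j 0) 0; first by rewrite conjC0 mul0r.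
  by rewrite (uniq1 j) ?u_fix ?eqxx in ji.
rewrite addr0 => /eqP; rewrite mulf_eq0 conjC_eq0 (negPf ui) /= => /eqP ->.
by rewrite normc0 expr0n !mulr0.
Qed.

Lemma one_mul : one^t* *m A = one^t*.
Proof.
have AE : A = A^t*.
  by have /is_hermitianmxP := A_herm; rewrite expr0 scale1r.
by rewrite [in LHS]AE -map_mxM -trmx_mul A_one.
Qed.

Local Notation J := (const_mx m%:R^-1 : 'M[C]_m).

(** The orthogonal complement of [one] is stable under [A] by [one_mul], so the one-step bound
    iterates. *)
Lemma nsq_exp_le s (w : 'cV[C]_m) : one^t* *m w = 0 ->
  nsq (A ^+ s *m w) <= (lam ^+ s) ^+ 2 * nsq w.
Proof.
elim: s w => [|s IH] w w0; first by rewrite !expr0 expr1n !mul1r mul1mx.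
rewrite [A ^+ _]exprSr -mulmxE -mulmxA (le_trans (IH _ _)) //.
  by rewrite mulmxA one_mul.
rewrite [lam ^+ _.+1]exprSr exprMn -[leRHS]mulrA ler_wpM2l ?sqr_ge0 //.
exact: nsq_orth_le.
Qed.

Lemma m_neq0 : m%:R != 0 :> C.
Proof. by rewrite pnatr_eq0 -lt0n. Qed.

Lemma J_mul (v : 'cV[C]_m) a : (J *m v) a 0 = (\sum_b v b 0) / m%:R.
Proof. by rewrite mxE mulr_suml; apply: eq_bigr => b _; rewrite mxE mulrC. Qed.

Lemma one_dot (v : 'cV[C]_m) : (one^t* *m v) 0 0 = \sum_b v b 0.
Proof. by rewrite dotE; apply: eq_bigr => b _; rewrite !mxE conjC1 mul1r. Qed.

(** This is Pythagoras for [J], the orthogonal projection onto the constant vectors. *)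
Lemma nsq_J (v : 'cV[C]_m) : nsq v = nsq (J *m v) + nsq (v - J *m v).
Proof.
apply: complexI; rewrite rmorphD /= !nsqC.
set M := (\sum_b v b 0) / m%:R.
under [X in _ = X + _]eq_bigr do rewrite J_mul -/M.
under [X in _ = _ + X]eq_bigr => a _ do
  rewrite mxE [in X in _ + X]mxE J_mul -/M normCK rmorphB mulrBr !mulrBl -normCK.
rewrite !sumrB !sumr_const -mulr_suml -mulr_sumr.
have -> : \sum_i v i 0 = M * m%:R by rewrite mulfVK ?m_neq0.
have -> : \sum_i (v i 0)^* = M^* * m%:R.
  by rewrite -rmorph_sum -(conjC_nat _ m) -rmorphM mulfVK ?m_neq0.
rewrite normCK card_ord -(mulr_natr (M * _)) mulrA [M * m%:R * _]mulrAC subrr subr0.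
by rewrite addrC subrK.
Qed.

Lemma nsq_J_le (v : 'cV[C]_m) : nsq (J *m v) <= nsq v.
Proof. by rewrite [leRHS]nsq_J lerDl nsq_ge0. Qed.

Lemma exp_J s : A ^+ s *m J = J.
Proof.
have JE : J = one *m const_mx (m%:R^-1).
  by apply/matrixP => i j; rewrite !mxE big_ord1 !mxE mul1r.
elim: s => [|s IH]; first by rewrite expr0 mul1mx.
by rewrite exprSr -mulmxE -mulmxA JE (mulmxA A) A_one -JE.
Qed.

Lemma J_exp s : J *m A ^+ s = J.
Proof.
have JE : J = const_mx (m%:R^-1) *m one^t*.
  by apply/matrixP => i j; rewrite !mxE big_ord1 !mxE conjC1 mulr1.
elim: s => [|s IH]; first by rewrite expr0 mulmx1.
by rewrite exprS -mulmxE mulmxA JE -(mulmxA _ _ A) one_mul -JE.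
Qed.

(** Since [A ^+ s] absorbs [J], the difference is [A ^+ s] applied to [v - J *m v], which is
    orthogonal to [one] and no longer than [v]. *)
Lemma nsq_exp_subJ_le s (v : 'cV[C]_m) :
  nsq ((A ^+ s - J) *m v) <= (lam ^+ s) ^+ 2 * nsq v.
Proof.
have -> : (A ^+ s - J) *m v = A ^+ s *m (v - J *m v).
  by rewrite mulmxBl mulmxBr mulmxA exp_J.
apply: le_trans (nsq_exp_le _ _) _.
  apply/matrixP => i j; rewrite !ord1 mulmxBr mxE [X in _ + X]mxE !one_dot mxE.
  under [X in _ - X]eq_bigr do rewrite J_mul.
  by rewrite sumr_const card_ord -(mulr_natr (_ / _)) mulfVK ?m_neq0 // subrr.
by rewrite ler_wpM2l ?sqr_ge0 // [leRHS]nsq_J lerDr nsq_ge0.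
Qed.

End Spectral.

(** * From random walks to chains of powers of the adjacency matrix *)

Section Walk.
Variables (R : realType) (V : finType) (e : rel V) (d : nat).
Hypotheses (e_sym : symmetric e) (d_gt0 : (0 < d)%N) (e_reg : regular e d).
Local Notation C := R[i].
Local Notation m := #|V|.
Local Notation A := (normalized_adj R e d).

Lemma sum_enum_val (M : nmodType) (F : V -> M) :
  \sum_y F y = \sum_(b < m) F (enum_val b).
Proof. by rewrite (reindex _ (onW_bij _ (enum_val_bij V))). Qed.

Lemma adjE a b : A a b = (unif R (nbrs e (enum_val a)) (enum_val b))%:C.
Proof. by rewrite mxE /unif e_reg inE fmorph_div /= !rmorph_nat. Qed.

Lemma adj_row_sum a : \sum_b A a b = 1.
Proof.
under eq_bigr do rewrite adjE.
rewrite -rmorph_sum -(sum_enum_val (unif R (nbrs e (enum_val a)))) /unif.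
rewrite -mulr_suml -natr_sum -big_mkcond /= sum1_card e_reg divff //.
by rewrite pnatr_eq0 -lt0n.
Qed.

Lemma adj_one : A *m (const_mx 1 : 'cV_m) = const_mx 1.
Proof.
apply/matrixP => a j; rewrite !mxE -[RHS](adj_row_sum a).
by apply: eq_bigr => b _; rewrite [const_mx _ _ _]mxE mulr1.
Qed.

Lemma adj_herm : A \is hermsymmx.
Proof.
apply/is_hermitianmxP; rewrite expr0 scale1r; apply/matrixP => a b.
by rewrite !mxE e_sym fmorph_div /= !rmorph_nat.
Qed.

Variable y0 : V.

(** This is the expectation conditioned on the starting vertex [x]. Positions index [x :: w], so
    position 0 is [x] and a walk with [n] further steps has positions 0 to [n]. *)
Definition walk_tens n k (D : 'I_k -> nat) (g : forall j, V -> 'M[C]_(D j))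
    (s : nat -> nat) (x : V) : 'M[C]_(tens_dim D) :=
  \sum_(w : n.-tuple V) (walk_from R e x w)%:C *:
    tens (fun j : 'I_k => g j (nth y0 (x :: w) (s j))).

Lemma eq_tens (K : comNzRingType) k (D : 'I_k -> nat) (M N : forall j, 'M[K]_(D j)) :
  (forall j, M j = N j) -> tens M = tens N.
Proof.
elim: k D M N => [//|k IH] D M N h /=.
by rewrite h; congr tensmx; apply: IH.
Qed.

Lemma walk_tens_step n k (D : 'I_k -> nat) (g : forall j, V -> 'M[C]_(D j))
    (s : nat -> nat) b : (forall j, (j < k)%N -> (0 < s j)%N) ->
  walk_tens n.+1 g s (enum_val b) =
  \sum_c A b c *: walk_tens n g (fun j => (s j).-1) (enum_val c).
Proof.
move=> s_gt0; rewrite /walk_tens big_tuple_cons sum_enum_val.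
apply: eq_bigr => c _; rewrite scaler_sumr; apply: eq_bigr => w _ /=.
rewrite adjE rmorphM scalerA; congr (_ *: _); apply: eq_tens => j.
by rewrite -(prednK (s_gt0 j (ltn_ord j))).
Qed.

(** [B] is the kernel by which the walk is entered: [J] for the whole walk, a power of [A] for a
    walk resumed midway, or a product of these. *)
Definition walk_ops (B : 'M[C]_m) (s : nat -> nat) (j : nat) : 'M[C]_m :=
  if j is j'.+1 then A ^+ (s j - s j')%N else B *m A ^+ s 0%N.

(** Induction on [n], with [B] arbitrary. If no function reads the current vertex, one step of the
    walk is absorbed into [B]; otherwise the first function is split off and the rest of the walk is
    entered by [A]. *)
Lemma walk_chain n k (D : 'I_k -> nat) (g : forall j, V -> 'M[C]_(D j))
    (s : nat -> nat) (B : 'M[C]_m) a :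
  (forall a, \sum_b B a b = 1) ->
  (forall j, (j < k)%N -> (s j <= n)%N) ->
  (forall i j, (i < j)%N -> (j < k)%N -> (s i < s j)%N) ->
  \sum_b B a b *: walk_tens n g s (enum_val b) =
  chain (fun j b => g j (enum_val b)) (walk_ops B s) a.
Proof.
elim: n k D g s B a => [|n IH] k D g s B a B1 s_le s_inc.
  rewrite /walk_tens; under eq_bigr do rewrite big_tuple_nil /= scale1r.
  (* With the single position 0 available, strictly increasing positions leave at most one
     function. *)
  case: k D g s_le s_inc => [|[|k]] D g s_le s_inc /=.
  - by rewrite -scaler_suml B1 scale1r.
  - have /eqP-> : s 0%N == 0%N by rewrite -leqn0 s_le.
    rewrite expr0 mulmx1; exact: eq_bigr.
  - have := s_inc 0%N 1%N isT isT.
    by rewrite ltnNge (leq_trans (s_le 1%N _)).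
have shift : (forall j, (j < k)%N -> (0 < s j)%N) ->
    \sum_b B a b *: walk_tens n.+1 g s (enum_val b) =
    chain (fun j b => g j (enum_val b)) (walk_ops B s) a.
  move=> s_gt0; under eq_bigr do rewrite walk_tens_step // scaler_sumr.
  rewrite exchange_big /=.
  under eq_bigr => c _.
    under eq_bigr do rewrite scalerA.
    rewrite -scaler_suml.
  over.
  transitivity (chain (fun j b => g j (enum_val b))
      (walk_ops (B *m A) (fun j => (s j).-1)) a).
    rewrite -IH => [|a'|j jk|i j ij jk].
    - by apply: eq_bigr => c _; rewrite mxE.
    (* The rows of [B *m A] still sum to 1. *)
    - under eq_bigr do rewrite mxE.
      rewrite exchange_big /=; under eq_bigr do rewrite -mulr_sumr adj_row_sum mulr1.
      exact: B1.
    - by rewrite -ltnS prednK ?s_le // s_gt0.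
    - by rewrite -ltnS !prednK ?s_gt0 ?s_inc // (ltn_trans ij).
  apply: eq_chain => -[|j] jk /=.
    rewrite -mulmxA -[in RHS](prednK (s_gt0 0%N jk)) exprS.
    by rewrite mulmxE.
  congr (_ ^+ _); rewrite -subSS !prednK ?s_gt0 //.
  exact: ltn_trans (ltnSn j) jk.
case: k D g s_le s_inc shift => [|k] D g s_le s_inc shift; first exact: shift.
have [s0|s0] := posnP (s 0%N); last first.
  by apply: shift => -[//|j] jk; rewrite (leq_ltn_trans _ (s_inc 0%N _ _ _)).
rewrite /= s0 expr0 mulmx1; apply: eq_bigr => b _; congr (_ *: _).
transitivity (tensmx (g ord0 (enum_val b))
    (walk_tens n.+1 (fun j => g (lift ord0 j)) (fun j => s j.+1) (enum_val b))).
  rewrite /walk_tens tensmx_sumr; apply: eq_bigr => w _.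
  by rewrite tensmxZr /= s0.
have s1_gt0 j : (j < k)%N -> (0 < s j.+1)%N.
  by move=> jk; rewrite -s0 s_inc.
congr tensmx; rewrite walk_tens_step //.
rewrite IH => [|a'|j jk|i j ij jk].
- apply: eq_chain => -[|j] jk /=.
    rewrite s0 subn0 -[in RHS](prednK (s1_gt0 0%N jk)) exprS.
    by rewrite mulmxE.
  congr (_ ^+ _); rewrite -subSS !prednK ?s1_gt0 //.
  exact: ltn_trans (ltnSn j) jk.
- exact: adj_row_sum.
- by rewrite -ltnS prednK ?s_le // s1_gt0.
- by rewrite -ltnS !prednK ?s1_gt0 ?s_inc // (ltn_trans ij).
Qed.

End Walk.

(** * Expansion of the kernels, vanishing terms and norm bounds *)

Section Expansion.
Variables (R : realType) (V : finType) (e : rel V) (d : nat) (lam : R).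
Hypotheses (V_nonempty : (0 < #|V|)%N) (e_sym : symmetric e) (d_gt0 : (0 < d)%N).
Hypotheses (e_reg : regular e d) (e_exp : expander e d lam).
Local Notation C := R[i].
Local Notation m := #|V|.
Local Notation A := (normalized_adj R e d).
Local Notation J := (const_mx m%:R^-1 : 'M[C]_m).

Lemma unif_setT x : (unif R [set: V] x)%:C = m%:R^-1.
Proof. by rewrite /unif inE cardsT mul1r fmorphV /= rmorph_nat. Qed.

Lemma expect_unif p (F : V -> 'M[C]_p) :
  expect (unif R [set: V]) F = m%:R^-1 *: \sum_(b < m) F (enum_val b).
Proof.
rewrite -(sum_enum_val F) scaler_sumr.
by apply: eq_bigr => x _; rewrite unif_setT.
Qed.

(** Every row of [J] is the uniform law of the first vertex, so the starting state [a] can be any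
    state. *)
Lemma expect_RW (n k : nat) (S : k.-tuple 'I_n) (D : 'I_k -> nat)
    (f : forall j : 'I_k, V -> 'M[C]_(D j)) (a : 'I_m) :
  (0 < n)%N -> sorted ltn (map val S) ->
  expect (RW R e (n := n)) (fun w => tens (fun j => f j (tnth w (tnth S j)))) =
  chain (fun j b => f j (enum_val b))
    (walk_ops e d J (nth 0%N (map val S))) a.
Proof.
case: n S => [//|n] S _ S_incr.
have sE (j : 'I_k) : nth 0%N (map val S) j = tnth S j.
  by rewrite (nth_map (tnth S j)) ?size_tuple // -tnth_nth.
have y0 := enum_val a.
rewrite -(@walk_chain R V e d d_gt0 e_reg y0 n) => [|b|j jk|i j ij jk].
- rewrite /expect big_tuple_cons sum_enum_val; apply: eq_bigr => b _.
  rewrite /walk_tens scaler_sumr; apply: eq_bigr => w _.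
  rewrite /RW /= rmorphM /= unif_setT mxE scalerA; congr (_ *: _).
  by apply: eq_tens => j; rewrite sE (tnth_nth y0).
- under eq_bigr do rewrite mxE.
  by rewrite sumr_const card_ord -(mulr_natr _^-1) mulVf // pnatr_eq0 -lt0n.
- by rewrite (sE (Ordinal jk)) -ltnS.
- by rewrite (sorted_ltn_nth ltn_trans) // inE size_map size_tuple // (ltn_trans ij).
Qed.

Variables (k : nat) (D : 'I_k.+1 -> nat) (g : forall j : 'I_k.+1, 'I_m -> 'M[C]_(D j)).
Variable delta : nat -> nat.
Hypothesis g_mean0 : forall j, \sum_b g j b = 0.
Hypothesis g_contr : forall j b v, nsq (g j b *m v) <= nsq v.

(* The kernels of the term of the expansion of [prod_j (J + (A ^+ delta j - J))]
   indexed by [I]; the initial kernel is always [J]. *)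
Definition split_ops (I : {set 'I_k}) (j : nat) : 'M[C]_m :=
  if nth false (false :: [tuple i \in I | i < k]) j
  then A ^+ delta j.-1 - J else J.

Lemma split_opsS I (j : 'I_k) :
  split_ops I j.+1 = if j \in I then A ^+ delta j - J else J.
Proof. by rewrite /split_ops /= nth_mktuple. Qed.

Lemma chain_split a T : T 0%N = J -> (forall j, (j < k)%N -> T j.+1 = A ^+ delta j) ->
  chain g T a = \sum_(I : {set 'I_k}) chain g (split_ops I) a.
Proof.
move=> T0 TS.
(* The initial kernel is not split: its second summand is 0, so the bit tuples starting with [true]
   contribute nothing and the remaining bits encode a set [I]. *)
pose Q j := if j is j'.+1 then A ^+ delta j' - J else 0 : 'M[C]_m.
pose G T' := chain g T' a.
change (G T = \sum_(I : {set 'I_k}) G (split_ops I)).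
have -> : G T = G (fun j => J + Q j).
  by apply: eq_chain => -[|j] jk; rewrite ?addr0 //= TS // addrC subrK.
have -> : G (fun j => J + Q j) =
    \sum_(b : k.+1.-tuple bool) G (fun j => if nth false b j then Q j else J).
  exact: (chainD g (fun=> J)).
rewrite big_tuple_cons big_bool /= [X in X + _]big1 ?add0r; last first.
  by move=> b _; apply: big1 => y _; rewrite mxE scale0r.
rewrite (reindex (fun I : {set 'I_k} => [tuple i \in I | i < k])) /=; last first.
  exists (fun b : k.-tuple bool => [set i | tnth b i]) => [I _|b _].
    by apply/setP => i; rewrite inE tnth_mktuple.
  by apply: eq_from_tnth => i; rewrite tnth_mktuple inE.
apply: eq_bigr => I _; apply: (@eq_chain _ _ _ _ g) => -[|j] jk; by rewrite /split_ops.
Qed.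

(** Each way of leaving the family gives a case of [chain_eq0]. If the first gap is missing, the
    first function lies between the initial [J] and another; if the last is missing, [J] precedes
    the last function; two missing neighbours put [J] on both sides of the function between them. *)
Lemma chain_split_eq0 I a : I \notin index_family k.+1 -> chain g (split_ops I) a = 0.
Proof.
rewrite inE negb_and => /orP[] /forallPn[/= j].
  rewrite negb_imply => /andP[/orP[/eqP j0|/eqP jk] jI].
    apply: (@chain_eq0 _ _ _ _ g _ 0) => //= _.
    by have := split_opsS I j; rewrite j0 (negPf jI).
  have kE : k = j.+1 by rewrite jk prednK // (leq_ltn_trans _ (ltn_ord j)).
  apply: (@chain_eq0 _ _ _ _ g _ j.+1) => //.
  - by rewrite ltnS.
  - by rewrite split_opsS (negPf jI).
  - by rewrite {2}kE ltnn.
rewrite negb_forall => /existsP[/= j']; rewrite negb_imply negb_or.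
move=> /andP[/andP[_ /eqP j'E] /andP[jI j'I]].
apply: (@chain_eq0 _ _ _ _ g _ j.+1) => //.
- by rewrite ltnS.
- by rewrite split_opsS (negPf jI).
- by rewrite -j'E split_opsS (negPf j'I).
Qed.

Lemma nsq_chain_split I a v :
  nsq (chain g (split_ops I) a *m v)
    <= (lam ^+ (\sum_(j in I) delta j)%N) ^+ 2 * nsq v.
Proof.
pose c j := if nth false (false :: [tuple i \in I | i < k]) j
  then lam ^+ delta j.-1 else 1.
have cI : \prod_(j < k.+1) c j = lam ^+ (\sum_(j in I) delta j)%N.
  rewrite big_ord_recl {1}/c /= mul1r -prodrXr [RHS]big_mkcond /=.
  by apply: eq_bigr => j _; rewrite /c /= nth_mktuple.
have mp : 0 < m%:R :> R by rewrite ltr0n.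
(* [chain_nsq_le] bounds the sum over all [m] starting states. The initial kernel [J] makes the
   summands equal, so the factor [m] cancels. *)
rewrite -(ler_pM2l mp) -cI mulrA.
apply: le_trans (chain_nsq_le (T := split_ops I) v g_contr _); last first.
  move=> j w _; rewrite /split_ops /c; case: ifP => _.
    exact: (nsq_exp_subJ_le V_nonempty (adj_herm R d e_sym) (adj_one R d_gt0 e_reg) e_exp).
  by rewrite expr1n mul1r nsq_J_le.
have -> : m%:R * nsq (chain g (split_ops I) a *m v) =
    \sum_(b < m) nsq (chain g (split_ops I) a *m v).
  by rewrite sumr_const card_ord mulr_natl.
apply: ler_sum => b _.
suff -> : chain g (split_ops I) a = chain g (split_ops I) b by [].
by apply: eq_bigr => y _; rewrite !mxE.
Qed.

End Expansion.

Theorem theorem3p1 (R : realType) (V : finType) (e : rel V) (d : nat) (lam : R)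
    (n k : nat) (S : k.-tuple 'I_n) (D : 'I_k -> nat)
    (f : forall j : 'I_k, V -> 'M[R[i]]_(D j))
    (V_nonempty : (0 < #|V|)%N)
    (e_sym : symmetric e)
    (d_gt0 : (0 < d)%N)
    (e_reg : regular e d)
    (lam_ge0 : 0 <= lam)
    (e_exp : expander e d lam)
    (n_ge1 : (1 <= n)%N)
    (k_ge2 : (2 <= k)%N)
    (S_incr : sorted ltn (map val S))
    (f_mean0 : forall j : 'I_k, expect (unif R [set: V]) (f j) = 0)
    (f_bound : forall (j : 'I_k) (x : V), opnorm (f j x) <= 1) :
  opnorm (expect (RW R e (n := n))
            (fun w => tens (fun j : 'I_k => f j (tnth w (tnth S j)))))
  <= \sum_(I in index_family k) lam ^+ (\sum_(j in I) gap S j)%N.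
Proof.
pose a := Ordinal V_nonempty.
have A_one := @adj_one R V e d d_gt0 e_reg.
rewrite (expect_RW V_nonempty d_gt0 e_reg f a) //.
case: k k_ge2 S D f S_incr f_mean0 f_bound => [//|k] _ S D f S_incr f_mean0 f_bound.
have f_sum0 j : \sum_(b < #|V|) f j (enum_val b) = 0.
  have /eqP := f_mean0 j; rewrite expect_unif scaler_eq0 invr_eq0 pnatr_eq0.
  by rewrite eqn0Ngt V_nonempty => /eqP.
have f_contr j (b : 'I_#|V|) w : nsq (f j (enum_val b) *m w) <= nsq w.
  exact: opnorm_le1.
(* The uniform law is stationary, so the steps before the first position of [S] are absorbed by
   [J]. *)
have T0 := J_exp (adj_herm R d e_sym) A_one (nth 0%N (map val S) 0%N).
rewrite (@chain_split R V e d k D _ (gap S) a _ T0) => [|//].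
rewrite (bigID (mem (index_family k.+1))) /= addrC big1 ?add0r; last first.
  by move=> I; exact: (chain_split_eq0 e d (gap S) f_sum0).
apply: opnorm_le => [|v]; first by apply: sumr_ge0 => I _; exact: exprn_ge0.
(* The factor [nsq v] is written as a square and moved into the sum, so that the triangle inequality
   applies with bounds [lam ^+ _ * l2norm v]. *)
rewrite mulmx_suml -[nsq v]sqr_l2norm -exprMn mulr_suml.
apply: nsq_sum_le => I _; first by rewrite mulr_ge0 ?exprn_ge0 ?l2norm_ge0.
rewrite exprMn sqr_l2norm.
exact: (nsq_chain_split V_nonempty e_sym d_gt0 e_reg e_exp (gap S) f_contr).
Qed.
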